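(* Let $h_1,h_2,\dots$ be real-valued independent identically distributed random variables on a probability space $(\Omega,\mathcal F,\mathbb P)$. For $\varepsilon>0$, $t>0$, $N\in\mathbb N$ define $\delta_t(\varepsilon)=\mathbb E(h_1\mathbf 1_{\{|h_1|\le\varepsilon t\}})$, $\delta_t=\delta_t(1)$; $\pi_N(\varepsilon)=\mathbb P\big(\big|\frac1N\sum_{n=1}^N h_n-\delta_N\big|>\varepsilon\big)$; $\tau_t(\varepsilon)=t\,\mathbb P(|h_1|>\varepsilon t)$; $\sigma_t(\varepsilon)=\frac1t\mathbb E(h_1^2\mathbf 1_{\{|h_1|\le\varepsilon t\}})$; $v_t(\varepsilon)=\frac1t\mathrm{Var}(h_1\mathbf 1_{\{|h_1|\le\varepsilon t\}})$; $\rho_t(\varepsilon)=\frac1t\mathbb E\big((|h_1|\wedge\varepsilon t)^2\big)$. Then the following are equivalent: (i) there exist real numbers $d_1,d_2,\dots$ such that for each $\varepsilon>0$, $\mathbb P\big(\big|\frac1N\sum_{n=1}^N h_n-d_N\big|>\varepsilon\big)\to0$ as $N\to\infty$; (ii) $\lim_{M\to\infty}\tau_M(\varepsilon)=0$ for every $\varepsilon>0$; (ii)$'$ $\lim_{M\to\infty}\sigma_M(\varepsilon)=0$ for every $\varepsilon>0$; (ii)$''$ $\lim_{M\to\infty}v_M(\varepsilon)=0$ for every $\varepsilon>0$; (ii)$'''$ $\lim_{M\to\infty}\rho_M(\varepsilon)=0$ for every $\varepsilon>0$; (iii) $\lim_{M\to\infty}\frac1M\int_0^M\tau_t(\varepsilon)\,dt=0$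 for every $\varepsilon>0$; (iii)$'$ $\lim_{M\to\infty}M\int_M^\infty\frac{\sigma_t(\varepsilon)}{t^2}\,dt=0$ for every $\varepsilon>0$; (iii)$''$ $\lim_{M\to\infty}M\int_M^\infty\frac{v_t(\varepsilon)}{t^2}\,dt=0$ for every $\varepsilon>0$. Moreover, when any (hence all) of (ii)–(iii)$''$ hold, (i) holds with $d_N=\delta_N$, i.e. $\pi_N(\varepsilon)\to0$ for every $\varepsilon>0$. *)

(* Defs.v *)
From HB Require Import structures.
From mathcomp Require Import all_boot all_order all_algebra.
From mathcomp Require Import all_classical all_reals all_analysis.
Set Implicit Arguments. Unset Strict Implicit. Unset Printing Implicit Defensive.
Import Order.TTheory GRing.Theory Num.Theory.
Import numFieldNormedType.Exports.
Local Open Scope classical_set_scope.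
Local Open Scope ring_scope.

Section Defs.
Context {R : realType} {d : measure_display} {T : measurableType d}.
Variable P : probability T R.

Definition mutually_independent (h : nat -> T -> R) : Prop :=
  forall (s : seq nat) (B : nat -> set R), uniq s ->
    (forall i, measurable (B i)) ->
    P (\bigcap_(i in [set i | i \in s]) (h i @^-1` B i)) =
    (\prod_(i <- s) P (h i @^-1` B i))%E.

Definition identically_distributed (h : nat -> T -> R) : Prop :=
  forall (n : nat) (B : set R), measurable B ->
    P (h n @^-1` B) = P (h 0%N @^-1` B).

Definition iid (h : nat -> T -> R) : Prop :=
  mutually_independent h /\ identically_distributed h.

Definition Exp (f : T -> R) : R := Rintegral P setT f.

Definition Var (f : T -> R) : R := Exp (fun x => (f x - Exp f) ^+ 2).

Definition trunc (X : T -> R) (eps t : R) : T -> R :=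
  fun x => if `|X x| <= eps * t then X x else 0.

Definition delta_ (X : T -> R) (t eps : R) : R := Exp (trunc X eps t).

Definition tau_ (X : T -> R) (t eps : R) : R :=
  t * fine (P [set x | eps * t < `|X x|]).

Definition sigma_ (X : T -> R) (t eps : R) : R :=
  t^-1 * Exp (fun x => (trunc X eps t x) ^+ 2).

Definition v_ (X : T -> R) (t eps : R) : R :=
  t^-1 * Var (trunc X eps t).

Definition rho_ (X : T -> R) (t eps : R) : R :=
  t^-1 * Exp (fun x => (Num.min `|X x| (eps * t)) ^+ 2).

Definition dev_prob (h : nat -> T -> R) (N : nat) (dN eps : R) : \bar R :=
  P [set x | eps < `| N%:R^-1 * \sum_(n < N) h n x - dN |].

End Defs.

(* Main.v *)
(* Everything is compared with the single condition s P(|h_1| > s) -> 0.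
   The capped second moment G(s) = E min(|h_1|, s)^2 satisfies
   G(2s) <= G(s) + 3 s^2 P(|h_1| > s), which gives G(s) / s -> 0; conversely
   s^2 P(|h_1| > s) <= G(s).  The truncated mean is o(t), so for 2s <= t <= 4s
   the truncated variance is at least s^2 / 4 * P(s < |h_1| <= 2s), and the
   dyadic increments of the tail are then summed.  The weak law follows by
   truncating at level N and Chebyshev's inequality.  The converse needs no
   symmetrization: if one summand exceeds 3a while the sum of the others, which
   is independent of it, is within 2a of the centring constant, then the whole
   sum deviates by more than a. *)
Require Import Defs.
From HB Require Import structures.
From mathcomp Require Import all_boot all_order all_algebra.
From mathcomp Require Import all_classical all_reals all_analysis.
From mathcomp Require Import measurable_realfun ring lra zify.
Set Implicit Arguments.
Unset Strict Implicit.
Unset Printing Implicit Defensive.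
Import Order.TTheory GRing.Theory Num.Theory.
Import numFieldNormedType.Exports.
Local Open Scope classical_set_scope.
Local Open Scope ring_scope.

(** * Expectation, variance and Chebyshev for bounded measurable functions *)

Section expectation.
Context {d : measure_display} {T : measurableType d} {R : realType}.
Variable P : probability T R.
Implicit Types (f g : T -> R) (A B : set T).

(** No moment of [h 0] is assumed finite, so every expectation taken below is that of a bounded
    measurable function; [mbounded] packages this and makes integrability automatic. In the variance
    conditions the squared mean could cancel most of the second moment. The mean must therefore be
    shown small before the decay of s P(|h_1| > s) is known. Only P(|h_1| > s) -> 0 is available
    then, and it suffices: splitting at a level a that is a small multiple of t bounds the mean by a
    + t P(|h_1| > a). In the converse, put p = P(|h_1| > N), z = k p, let q be the deviation
    probability and r = q + P(|h_1| > N / 3). The events that term k is large and the others are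
    close overlap for different k; removing the overlaps costs the quadratic term in z (1 - r - z)
    <= q. Taken at k = N alone this also admits large z. It is therefore proved for all k <= N: z
    starts at 0 and its steps p are too small to jump over the forbidden middle range. *)

Definition mbounded f :=
  measurable_fun setT f /\ exists M, forall x, `|f x| <= M.

Lemma mbounded_integrable f : mbounded f -> P.-integrable setT (EFin \o f).
Proof.
move=> [mf [M fM]]; apply: measurable_bounded_integrable => //.
  by rewrite (le_lt_trans (probability_le1 _ _)) ?ltry.
by exists M; split => [|N MN x _]; rewrite ?num_real//= (le_trans (fM x)) ?ltW.
Qed.

Lemma mbounded_cst c : mbounded (cst c).
Proof. by split => //; exists `|c|. Qed.

Lemma mboundedD f g : mbounded f -> mbounded g -> mbounded (fun x => f x + g x).
Proof.
move=> [mf [M fM]] [mg [N gN]]; split; first exact: measurable_funD.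
by exists (M + N) => x; rewrite (le_trans (ler_normD _ _)) ?lerD.
Qed.

Lemma mboundedM f g : mbounded f -> mbounded g -> mbounded (fun x => f x * g x).
Proof.
move=> [mf [M fM]] [mg [N gN]]; split; first exact: measurable_funM.
by exists (M * N) => x; rewrite normrM ler_pM.
Qed.

Lemma mboundedB f g : mbounded f -> mbounded g -> mbounded (fun x => f x - g x).
Proof.
move=> [mf [M fM]] [mg [N gN]]; split; first exact: measurable_funB.
by exists (M + N) => x; rewrite (le_trans (ler_normB _ _)) ?lerD.
Qed.

Lemma mboundedX f : mbounded f -> mbounded (fun x => f x ^+ 2).
Proof. by move=> bf; under eq_fun do rewrite expr2; exact: mboundedM. Qed.

Lemma mbounded_sum (I : Type) (s : seq I) (f : I -> T -> R) :
  (forall i, mbounded (f i)) -> mbounded (fun x => \sum_(i <- s) f i x).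
Proof.
move=> bf; elim: s => [|i s ih].
  by under eq_fun do rewrite big_nil; exact: mbounded_cst.
by under eq_fun do rewrite big_cons; exact: mboundedD.
Qed.

Lemma mbounded_indic A : measurable A -> mbounded \1_A.
Proof.
move=> mA; split; first exact: measurable_indic.
by exists 1 => x; rewrite indicE; case: (_ \in _); rewrite ?normr1 ?normr0.
Qed.

Lemma fine_prob_ge0 A : 0 <= fine (P A). Proof. exact: fine_ge0. Qed.

Lemma fine_prob_le1 A : measurable A -> fine (P A) <= 1.
Proof.
by move=> mA; rewrite -lee_fin fineK ?fin_num_measure// probability_le1.
Qed.

Lemma fine_probE A : measurable A -> P A = (fine (P A))%:E.
Proof. by move=> mA; rewrite fineK ?fin_num_measure. Qed.

Lemma fine_prob_le A B : measurable A -> measurable B -> A `<=` B ->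
  fine (P A) <= fine (P B).
Proof.
by move=> mA mB AB; rewrite fine_le ?fin_num_measure// le_measure ?inE.
Qed.

Lemma fine_probU A B : measurable A -> measurable B ->
  fine (P (A `|` B)) <= fine (P A) + fine (P B).
Proof.
move=> mA mB; rewrite -lee_fin EFinD !fineK ?fin_num_measure ?measureU2//.
exact: measurableU.
Qed.

Lemma fine_prob_setC A : measurable A -> fine (P (~` A)) = 1 - fine (P A).
Proof.
by move=> mA; rewrite probability_setC// fineB ?fin_num_measure.
Qed.

Lemma Exp_indic A : measurable A -> Exp P \1_A = fine (P A).
Proof.
move=> mA; rewrite /Exp /Rintegral.
by rewrite integral_indic// setIT.
Qed.

Lemma ExpD f g : mbounded f -> mbounded g ->
  Exp P (fun x => f x + g x) = Exp P f + Exp P g.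
Proof. by move=> bf bg; apply: RintegralD => //; exact: mbounded_integrable. Qed.

Lemma ExpB f g : mbounded f -> mbounded g ->
  Exp P (fun x => f x - g x) = Exp P f - Exp P g.
Proof. by move=> bf bg; apply: RintegralB => //; exact: mbounded_integrable. Qed.

Lemma ExpZ c f : mbounded f -> Exp P (fun x => c * f x) = c * Exp P f.
Proof. by move=> bf; apply: RintegralZl => //; exact: mbounded_integrable. Qed.

Lemma Exp_cst c : Exp P (cst c) = c.
Proof.
by rewrite /Exp Rintegral_cst//= -[X in fine X]/(P setT) probability_setT mulr1.
Qed.

Lemma Exp_le f g : mbounded f -> mbounded g -> (forall x, f x <= g x) ->
  Exp P f <= Exp P g.
Proof.
by move=> bf bg fg; apply: le_Rintegral => //; exact: mbounded_integrable.
Qed.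

Lemma Exp_ge0 f : (forall x, 0 <= f x) -> 0 <= Exp P f.
Proof. by move=> f0; exact: Rintegral_ge0. Qed.

Lemma Exp_sum (I : Type) (s : seq I) (f : I -> T -> R) :
  (forall i, mbounded (f i)) ->
  Exp P (fun x => \sum_(i <- s) f i x) = \sum_(i <- s) Exp P (f i).
Proof.
move=> bf; elim: s => [|i s ih].
  by under eq_fun do rewrite big_nil; rewrite big_nil; exact: Exp_cst.
under eq_fun do rewrite big_cons.
by rewrite big_cons ExpD ?ih//; exact: mbounded_sum.
Qed.

Lemma VarE f : mbounded f -> Var P f = Exp P (fun x => f x ^+ 2) - Exp P f ^+ 2.
Proof.
move=> bf; rewrite /Var; set m := Exp P f.
rewrite (_ : (fun x => _) = (fun x => (f x ^+ 2 - (2 * m) * f x) + m ^+ 2)).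
  have b2 := mboundedX bf; have bc := mbounded_cst.
  rewrite ExpD ?ExpB ?ExpZ ?Exp_cst// -/m; first by ring.
  all: try exact: bc.
  all: try exact: (mboundedM (bc (2 * m)) bf).
  exact: (mboundedB b2 (mboundedM (bc (2 * m)) bf)).
by apply/funext => x; ring.
Qed.

Lemma Var_ge0 f : 0 <= Var P f.
Proof. by apply: Exp_ge0 => x; exact: sqr_ge0. Qed.

Lemma Var_le_sqr f : mbounded f -> Var P f <= Exp P (fun x => f x ^+ 2).
Proof. by move=> bf; rewrite VarE// lerBlDr lerDl sqr_ge0. Qed.

Lemma sqr_markov f (c : R) : mbounded f -> 0 <= c ->
  c ^+ 2 * fine (P [set x | c < `|f x|]) <= Exp P (fun x => f x ^+ 2).
Proof.
move=> bf c0; have mA : measurable [set x | c < `|f x|].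
  have := bf.1 => mf; rewrite -[X in measurable X]setTI.
  by apply: measurable_fun_ltr => //; exact: measurableT_comp.
rewrite -Exp_indic// -ExpZ; last exact: mbounded_indic.
apply: Exp_le; [|exact: mboundedX|move=> x].
  by apply: mboundedM; [exact: mbounded_cst|exact: mbounded_indic].
rewrite indicE; case: (boolP (x \in _)) => [|_]; last by rewrite mulr0 sqr_ge0.
rewrite inE/= mulr1 -(real_normK (num_real (f x))) => cf.
by rewrite lerXn2r ?nnegrE// ltW.
Qed.

End expectation.

(** * Truncated and capped moments against the tail of [|X|] *)

Section truncation.
Context {d : measure_display} {T : measurableType d} {R : realType}.
Variables (P : probability T R) (X : T -> R).
Hypothesis mX : measurable_fun setT X.

(** [trunc] with its level [eps * t] as a single parameter: [sigma_] and [v_] become functions of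
    [cut] by conversion, and [eps] is reduced to a rescaling of [t]. *)
Definition cut (s : R) : T -> R := fun x => if `|X x| <= s then X x else 0.

Definition capsq (s : R) : R := Exp P (fun x => Num.min `|X x| s ^+ 2).

Definition cutsq (s : R) : R := Exp P (fun x => cut s x ^+ 2).

Definition tail (s : R) : R := fine (P [set x | s < `|X x|]).

Let mabs : measurable_fun setT (fun x => `|X x|).
Proof. exact: measurableT_comp. Qed.

Lemma measurable_tail_set (s : R) : measurable [set x | s < `|X x|].
Proof.
by rewrite -[X in measurable X]setTI; apply: measurable_fun_ltr.
Qed.
Let mtail := measurable_tail_set.

Lemma mbounded_tail_indic (s : R) : mbounded (\1_[set x | s < `|X x|] : T -> R).
Proof. exact: mbounded_indic. Qed.

Lemma mbounded_cut s : mbounded (cut s).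
Proof.
split; first by apply: measurable_fun_ifT => //; exact: measurable_fun_ler.
exists `|s| => x; rewrite /cut; case: ifPn => [/le_trans->//|_].
  exact: ler_norm.
by rewrite normr0.
Qed.

Lemma mbounded_cap s : 0 <= s -> mbounded (fun x => Num.min `|X x| s).
Proof.
move=> s0; split; first exact: measurable_minr.
by exists s => x; rewrite ger0_norm ?le_min ?normr_ge0//= ge_min lexx orbT.
Qed.

Lemma tail_ge0 s : 0 <= tail s. Proof. exact: fine_prob_ge0. Qed.

Lemma tail_nonincreasing s t : s <= t -> tail t <= tail s.
Proof. by move=> st; apply: fine_prob_le => // x; exact: le_lt_trans. Qed.

(** [tail] is the complementary distribution function of [|X|], and a real-valued variable has no
    mass at infinity. *)
Lemma tail_cvg0 : tail s @[s --> +oo] --> 0.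
Proof.
pose Y : {RV P >-> R} := MeasurableFun.Pack (MeasurableFun.Class
  (isMeasurableFun.Build _ _ _ _ _ mabs)).
have /fine_cvg : (ccdf Y s @[s --> +oo%R] --> 0)%E := @cvg_ccdfy0 _ _ _ P Y.
apply: cvg_trans.
apply: near_eq_cvg; apply: nearW => s.
rewrite /ccdf /distribution /pushforward/= /tail; congr (fine (P _)).
by apply/seteqP; split=> x/=; rewrite in_itv/= andbT.
Qed.

Lemma indicatorE (s : R) x :
  \1_[set x | s < `|X x|] x = (s < `|X x|)%R%:R :> R.
Proof.
by rewrite indicE; congr ((nat_of_bool _)%:R); apply/idP/idP; rewrite inE.
Qed.

Lemma capsq_ge0 s : 0 <= capsq s.
Proof. by apply: Exp_ge0 => x; exact: sqr_ge0. Qed.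

Lemma cutsq_ge0 s : 0 <= cutsq s.
Proof. by apply: Exp_ge0 => x; exact: sqr_ge0. Qed.

Lemma capsq_le_sqr s : 0 <= s -> capsq s <= s ^+ 2.
Proof.
move=> s0; rewrite -[leRHS](Exp_cst P); apply: Exp_le => [||x].
- exact/mboundedX/mbounded_cap.
- exact: mbounded_cst.
- by rewrite /= lerXn2r ?nnegrE ?le_min ?normr_ge0//= ge_min lexx orbT.
Qed.

Lemma cutsq_le_capsq s : 0 <= s -> cutsq s <= capsq s.
Proof.
move=> s0; apply: Exp_le => [||x]; first exact/mboundedX/mbounded_cut.
  exact/mboundedX/mbounded_cap.
rewrite /cut; case: ifPn => [/min_idPl->|_]; last by rewrite expr0n sqr_ge0.
by rewrite real_normK ?num_real.
Qed.

Lemma tail_le_capsq s : 0 <= s -> s ^+ 2 * tail s <= capsq s.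
Proof.
move=> s0; rewrite /tail -Exp_indic// -ExpZ; last exact: mbounded_tail_indic.
apply: Exp_le => [||x]; last 1 first.
- rewrite indicatorE; case: ltP => _; first by rewrite mulr1.
  by rewrite mulr0 sqr_ge0.
- exact/mboundedM/mbounded_tail_indic/mbounded_cst.
- exact/mboundedX/mbounded_cap.
Qed.

(** Doubling the cap changes nothing where [|X| <= s]; elsewhere the square rises from [s ^+ 2] to
    at most [4 * s ^+ 2], whence the 3. *)
Lemma capsq_double s : 0 <= s -> capsq (2 * s) <= capsq s + 3 * s ^+ 2 * tail s.
Proof.
move=> s0; have b1 := mbounded_tail_indic s.
have b2 := mboundedM (mbounded_cst (3 * s ^+ 2)) b1.
have b3 := mboundedX (mbounded_cap s0).
rewrite /tail -Exp_indic// -ExpZ// -ExpD//.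
apply: Exp_le => [||x]; first by apply/mboundedX/mbounded_cap; rewrite mulr_ge0.
  exact: mboundedD.
rewrite indicatorE; case: (ltP s `|X x|) => h; last first.
  by rewrite mulr0 addr0 !min_l//; lra.
rewrite mulr1.
have -> : s ^+ 2 + 3 * s ^+ 2 = (2 * s) ^+ 2 by ring.
rewrite lerXn2r ?nnegrE ?ge_min ?lexx ?orbT// ?le_min ?normr_ge0/= mulr_ge0//.
Qed.

(** Pointwise, [|cut t|] is at most [a] where [|X| <= a] and at most [t] elsewhere. *)
Lemma mean_cut_bound a t : 0 <= a -> 0 <= t ->
  `|Exp P (cut t)| <= a + t * tail a.
Proof.
move=> a0 t0; have b1 := mbounded_tail_indic a.
have b2 := mboundedM (mbounded_cst t) b1.
have b3 := mbounded_cst a : mbounded (cst a : T -> R).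
apply: (le_trans (le_normr_Rintegral _ _)) => //.
  exact/mbounded_integrable/mbounded_cut.
rewrite -[X in X + _](Exp_cst P) /tail -Exp_indic// -ExpZ// -ExpD//.
apply: Exp_le => [||x]; last 1 first.
- rewrite /= indicatorE /cut.
  case: ifPn => h; last by rewrite normr0 addr_ge0// mulr_ge0.
  by case: (ltP a) => h'; rewrite ?mulr1 ?mulr0; lra.
- have [mc [M cM]] := mbounded_cut t.
  split; first exact: (measurableT_comp _ mc).
  by exists M => x; rewrite normr_id cM.
- exact: mboundedD.
Qed.

Lemma Var_cut_le_cutsq s : Var P (cut s) <= cutsq s.
Proof. exact/Var_le_sqr/mbounded_cut. Qed.

(** Where [s < |X| <= 2 * s] the truncation at [t] keeps [X], which lies at distance at least
    [s - s / 2] from the mean. *)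
Lemma Var_cut_ge s t : 0 <= s -> 2 * s <= t -> `|Exp P (cut t)| <= s / 2 ->
  s ^+ 2 / 4 * (tail s - tail (2 * s)) <= Var P (cut t).
Proof.
move=> s0 st; set m := Exp P _ => ms.
have b1 := mbounded_tail_indic s; have b2 := mbounded_tail_indic (2 * s).
have b12 := mboundedB b1 b2.
rewrite /tail -!Exp_indic// -ExpB// -ExpZ//.
apply: Exp_le => [||x].
- exact/mboundedM/b12/mbounded_cst.
- exact/mboundedX/mboundedB/mbounded_cst/mbounded_cut.
rewrite !indicatorE.
have [h|h] := ltP (2 * s) `|X x|.
  have -> : s < `|X x| by lra.
  by rewrite subrr mulr0 sqr_ge0.
rewrite subr0; have [h'|h'] := ltP s `|X x|; last by rewrite mulr0 sqr_ge0.
rewrite mulr1 /cut (le_trans h st) -/m.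
have -> : s ^+ 2 / 4 = (s / 2) ^+ 2 by field.
rewrite -[leRHS]real_normK ?num_real// lerXn2r ?nnegrE ?normr_ge0//.
  by rewrite divr_ge0.
by have := lerB_dist (X x) m; lra.
Qed.

End truncation.

(** * Limits at infinity along dyadic scales *)

Section limits.
Context {R : realType}.
Implicit Types (f g r : R -> R).

Lemma near_pinftyP (Q : R -> Prop) : (\forall s \near +oo, Q s) <->
  exists2 S, 0 < S & forall s, S <= s -> Q s.
Proof.
split=> [[M [_ MQ]]|[S S0 SQ]]; last first.
  by exists S; split => [|s /ltW]; [exact: num_real|exact: SQ].
exists (`|M| + 1) => [|s Ms]; first by rewrite ltr_pwDr.
by apply: MQ; have := ler_norm M; lra.
Qed.

Lemma cvgy0P f : (forall s, 0 < s -> 0 <= f s) ->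
  f s @[s --> +oo] --> 0 <->
  forall e, 0 < e -> exists2 S, 0 < S & forall s, S <= s -> f s <= e.
Proof.
move=> f0; rewrite cvgr0Pnorm_le; split=> fe e /fe => [/near_pinftyP|] [S S0 Se].
  by exists S => // s /Se; exact/le_trans/ler_norm.
apply/near_pinftyP; exists S => // s Ss.
by rewrite ger0_norm ?f0 ?Se// (lt_le_trans S0).
Qed.

(** Convergence to a finite limit in [\bar R] includes eventual finiteness, which the bound for
    [e = 1] supplies. *)
Lemma cvge0P (T : Type) (F : set_system T) {FF : Filter F} (u : T -> \bar R) :
  (\forall x \near F, 0 <= u x)%E ->
  u x @[x --> F] --> 0%E <->
  forall e : R, 0 < e -> \forall x \near F, (u x <= e%:E)%E.
Proof.
move=> u0; split=> [/fine_cvgP[uf /cvgr0Pnorm_le uc] e /uc ue|ue].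
  near=> x; have xf : u x \is a fin_num by near: x.
  rewrite -[u x]fineK// lee_fin (le_trans (ler_norm _))//.
  by near: x.
have uf : \forall x \near F, u x \is a fin_num.
  near=> x; rewrite ge0_fin_numE; last by near: x.
  by rewrite (@le_lt_trans _ _ 1%:E) ?ltry//; near: x; exact: ue.
apply/fine_cvgP; split => //; apply/cvgr0Pnorm_le => e e0.
near=> x; have xf : u x \is a fin_num by near: x.
rewrite /= ger0_norm ?fine_ge0//; last by near: x.
by rewrite -lee_fin fineK//; near: x; exact: ue.
Unshelve. all: by end_near. Qed.

Lemma cvgy_scale f (a e : R) : 0 < e ->
  f s @[s --> +oo] --> a -> f (e * t) @[t --> +oo] --> a.
Proof.
move=> e0; apply: cvg_comp => Q [M [_ MQ]].
exists (M / e); split => [|t]; first exact: num_real.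
by rewrite ltr_pdivrMr// mulrC; exact: MQ.
Qed.

(* The bound [C / s + e / 2] is stable under the recursion. *)
Lemma cvg0_halving r g : (forall s, 0 < s -> 0 <= r s <= s) ->
  (forall s, 0 < s -> r (2 * s) <= r s / 2 + g s) ->
  g s @[s --> +oo] --> 0 -> r s @[s --> +oo] --> 0.
Proof.
move=> rs rg /cvgr0Pnorm_le g0.
apply/cvgy0P => [s /rs/andP[]//|e e0].
have /near_pinftyP[S S0 gS] := g0 (e / 4) ltac:(by rewrite divr_gt0).
(* [n] only measures how far [s] may reach. On [[S, 2 * S]] the a priori bound [r s <= s] already
   gives [s <= 4 * S ^+ 2 / s]; beyond [2 * S], halving sends [s <= n.+3%:R * S] below
   [n.+2%:R * S]. *)
have bound n s : S <= s <= n.+2%:R * S -> r s <= 4 * S ^+ 2 / s + e / 2.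
  elim: n s => [|n ih] s /andP[Ss sn].
    have s0 : 0 < s by lra.
    have : s <= 4 * S ^+ 2 / s.
      rewrite ler_pdivlMr// -expr2.
      by rewrite (_ : 4 * _ = (2 * S) ^+ 2) ?lerXn2r ?nnegrE//; [lra|lra|ring].
    by have /andP[_] := rs _ s0; lra.
  have [s2|s2] := leP s (2 * S).
    by apply: ih; rewrite Ss (le_trans s2)// ler_pM2r// ler_nat.
  have h0 : 0 < s / 2 by lra.
  have sE : s = 2 * (s / 2) by field.
  have {}ih : r (s / 2) <= 4 * S ^+ 2 / (s / 2) + e / 2.
    apply: ih; apply/andP; split; first lra.
    rewrite ler_pdivrMr// (le_trans sn)// -mulrA [S * 2]mulrC mulrA ler_pM2r//.
    by rewrite -natrM ler_nat; lia.
  have := rg _ h0; rewrite -sE.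
  have -> : 4 * S ^+ 2 / s = (4 * S ^+ 2 / (s / 2)) / 2 by field; lra.
  have := gS (s / 2) ltac:(lra); have := ler_norm (g (s / 2)); lra.
exists (S + 8 * S ^+ 2 / e) => [|s Ss].
  by rewrite ltr_pwDl// divr_ge0 ?mulr_ge0 ?sqr_ge0 ?ltW.
have SS : 0 <= 8 * S ^+ 2 / e by rewrite divr_ge0 ?mulr_ge0 ?sqr_ge0 ?ltW.
have s0 : 0 < s by lra.
apply: (le_trans (bound (Num.trunc (s / S)) s _)).
  rewrite -ler_pdivrMr//; apply/andP; split; first lra.
  have /andP[_ /ltW/le_trans->//] := truncn_itv (ltW (divr_gt0 s0 S0)).
  by rewrite ler_nat.
suff : 4 * S ^+ 2 / s <= e / 2 by lra.
rewrite ler_pdivrMr//.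
have : 8 * S ^+ 2 / e <= s by lra.
by rewrite ler_pdivrMr//; lra.
Qed.

(** Write [f s] as [f (2 ^+ n * s)] plus the increments at [s, 2 s, 4 s, ...]. The increment at [t]
    is at most [e / 2 / t], so they add up to a geometric sum below [e / s], and the remaining term
    vanishes as [n] grows. *)
Lemma cvg0_dyadic_telescope f : (forall s, 0 < s -> 0 <= f s) ->
  f s @[s --> +oo] --> 0 ->
  s * (f s - f (2 * s)) @[s --> +oo] --> 0 ->
  s * f s @[s --> +oo] --> 0.
Proof.
move=> f0 /cvgr0Pnorm_le fc /cvgr0Pnorm_le df.
apply/cvgy0P => [s s0|e e0]; first by rewrite mulr_ge0 ?f0 ?ltW.
have /near_pinftyP[S S0 dS] := df (e / 2) ltac:(by rewrite divr_gt0).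
exists S => // s Ss.
have step n : f s <= f (2 ^+ n * s) + e / s * (1 - 2 ^- n).
  elim: n => [|n ih]; first by rewrite expr0 mul1r invr1 subrr mulr0 addr0.
  apply: (le_trans ih); set t := 2 ^+ n * s.
  have t1 : 1 <= 2 ^+ n :> R by rewrite exprn_ege1// ler1n.
  have tS : S <= t by rewrite (le_trans Ss)// ler_peMl//; lra.
  have t0 : 0 < t by lra.
  have := dS t tS; move=> /(le_trans (ler_norm _)).
  rewrite mulrC -ler_pdivlMr// => ht.
  have -> : 2 ^+ n.+1 * s = 2 * t by rewrite exprS mulrA.
  have -> : e / s * (1 - 2 ^- n.+1) = e / s * (1 - 2 ^- n) + e / 2 / t.
    by rewrite /t exprS; field; rewrite expf_neq0 ?gt_eqF//=; lra.
  by lra.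
have s0 : 0 < s by lra.
rewrite -ler_pdivlMl// [leRHS]mulrC; apply/ler_addgt0Pr => a a0.
have /near_pinftyP[U U0 fU] := fc a a0.
have [n Un] : exists n, U <= 2 ^+ n * s.
  exists (Num.trunc (U / s)).+1; rewrite -ler_pdivrMr//.
  have /andP[_ /ltW/le_trans->//] := truncn_itv (ltW (divr_gt0 U0 s0)).
  by rewrite -natrX ler_nat ltnW// ltn_expl.
apply: (le_trans (step n)); rewrite addrC lerD//.
  rewrite ler_piMr ?divr_ge0 ?ltW// gerBl// invr_ge0 exprn_ge0.
by rewrite (le_trans (ler_norm _))// fU.
Qed.

End limits.

(** * Comparison of Lebesgue integrals over half-lines and intervals *)

Section integrals.
Context {R : realType}.
Notation mu := (@lebesgue_measure R).

(** The integral of a nonnegative function is a supremum over simple functions below it, so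
    monotonicity is an inclusion of index sets. This spares proving that [tau_], [sigma_] and [v_]
    are measurable in [t]. *)
Lemma ge0_le_integral_nonmeasurable (D : set R) (f g : R -> \bar R) :
  (forall x, D x -> 0 <= f x)%E -> (forall x, D x -> f x <= g x)%E ->
  (\int[mu]_(x in D) f x <= \int[mu]_(x in D) g x)%E.
Proof.
move=> f0 fg; have g0 x : D x -> (0 <= g x)%E.
  by move=> Dx; exact: le_trans (f0 x Dx) (fg x Dx).
rewrite !ge0_integralE//; apply: le_ereal_sup => _ [h /= hf <-].
exists h => //= x; apply: (le_trans (hf x)).
by rewrite /patch; case: ifPn => //; rewrite inE; exact: fg.
Qed.

Lemma integral_cst_indic (D A : set R) (c : R) :
  measurable D -> measurable A -> 0 <= c ->
  (\int[mu]_(x in D) (c * \1_A x)%:E = c%:E * mu (A `&` D))%E.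
Proof.
move=> mD mA c0; under eq_integral do rewrite EFinM.
rewrite ge0_integralZl//; first by rewrite integral_indic.
by apply: measurableT_comp => //; exact: measurable_indic.
Qed.

Lemma cst_le_integral (D A : set R) (f : R -> \bar R) (c : R) :
  measurable D -> measurable A -> A `<=` D -> 0 <= c ->
  (forall x, D x -> 0 <= f x)%E -> (forall x, A x -> c%:E <= f x)%E ->
  (c%:E * mu A <= \int[mu]_(x in D) f x)%E.
Proof.
move=> mD mA AD c0 f0 fc.
rewrite -[A in mu A](setIidl AD) -integral_cst_indic//.
apply: ge0_le_integral_nonmeasurable => x Dx.
  by rewrite lee_fin mulr_ge0.
rewrite indicE; case: (boolP (x \in A)) => [|_]; last by rewrite mulr0 f0.
by rewrite inE mulr1; exact: fc.
Qed.

Lemma mu_itvcc (a b : R) : a <= b -> mu `[a, b] = (b - a)%:E.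
Proof.
rewrite lebesgue_measure_itv/= lte_fin; case: ltP => //.
by move=> ba ab; rewrite (le_anti (_ : a <= b <= a)) ?subrr// ab.
Qed.

Lemma integral_inv_sqr (c M : R) : 0 <= c -> 0 < M ->
  (\int[mu]_(t in `[M, +oo[) (c / t ^+ 2)%:E = (c / M)%:E)%E.
Proof.
move=> c0 M0.
have dF (x : R) : 0 < x -> is_derive x 1 (fun t => - (c / t)) (c / x ^+ 2).
  move=> x0; have xN0 : x != 0 by rewrite gt_eqF.
  have dV := @derivableV _ _ id x 1 xN0 (@derivable_id _ _ x 1).
  have DV := deriveV xN0 (@derivable_id _ _ x 1).
  have := is_deriveN (is_deriveZ c (DeriveDef dV DV)).
  rewrite derive_id /GRing.scale/= mulr1 mulrN opprK.
  exact.
rewrite (@ge0_continuous_FTC2y _ _ (fun t => - (c / t)) _ 0).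
- by rewrite -EFinB sub0r opprK.
- by move=> x Mx; rewrite divr_ge0 ?sqr_ge0.
- apply: continuous_in_subspaceT => x; rewrite inE/= in_itv/= andbT => Mx.
  have xN0 : x ^+ 2 != 0 by rewrite expf_neq0 ?gt_eqF//; lra.
  apply: cvgM; first exact: cvg_cst.
  by apply: cvgV => //; exact: exprn_continuous.
- rewrite -oppr0; apply: cvgN; rewrite -(mulr0 c); apply: cvgM.
    exact: cvg_cst.
  by apply/gtr0_cvgV0; [exact: nbhs_pinfty_gt|exact: cvg_id].
- by move=> x Mx; have [] := dF x (lt_trans M0 Mx).
- apply: cvg_at_right_filter; apply: cvgN; apply: cvgM; first exact: cvg_cst.
  by apply: cvgV => //; rewrite gt_eqF.
- move=> x; rewrite in_itv/= andbT => Mx.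
  have [_ <-] := dF x (lt_trans M0 Mx); exact: derive1E.
Qed.

End integrals.

(** * Each analytic condition against [s * tail s --> 0] *)

Section equivalences.
Context {d : measure_display} {T : measurableType d} {R : realType}.
Variables (P : probability T R) (X : T -> R).
Hypothesis mX : measurable_fun setT X.
Notation mu := (@lebesgue_measure R).
Notation tailX := (tail P X).

Let tail_term_ge0 (s : R) : 0 < s -> 0 <= s * tailX s.
Proof. by move=> s0; rewrite mulr_ge0 ?tail_ge0 ?ltW. Qed.

Lemma tau_tail t e : 0 < e -> tau_ P X t e = e^-1 * ((e * t) * tailX (e * t)).
Proof. by move=> e0; rewrite /tau_ /tail; field; rewrite gt_eqF. Qed.

Lemma sigma_cutsq t e : sigma_ P X t e = t^-1 * cutsq P X (e * t).
Proof. by []. Qed.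

Lemma v_Var_cut t e : v_ P X t e = t^-1 * Var P (cut X (e * t)).
Proof. by []. Qed.

Lemma rho_capsq t e : rho_ P X t e = t^-1 * capsq P X (e * t).
Proof. by []. Qed.

Lemma tau_ge0 t e : 0 <= t -> 0 <= tau_ P X t e.
Proof. by move=> t0; rewrite mulr_ge0 ?fine_prob_ge0. Qed.

Lemma sigma_ge0 t e : 0 <= t -> 0 <= sigma_ P X t e.
Proof. by move=> t0; rewrite sigma_cutsq mulr_ge0 ?invr_ge0 ?cutsq_ge0. Qed.

Lemma v_ge0 t e : 0 <= t -> 0 <= v_ P X t e.
Proof. by move=> t0; rewrite v_Var_cut mulr_ge0 ?invr_ge0 ?Var_ge0. Qed.

Lemma v_le_sigma t e : 0 <= t -> v_ P X t e <= sigma_ P X t e.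
Proof.
by move=> t0; rewrite v_Var_cut sigma_cutsq ler_wpM2l ?invr_ge0 ?Var_cut_le_cutsq.
Qed.

Lemma cvg_tau e : 0 < e -> s * tailX s @[s --> +oo] --> 0 ->
  tau_ P X t e @[t --> +oo] --> 0.
Proof.
move=> e0 ht; under eq_fun do rewrite tau_tail//.
rewrite -(mulr0 e^-1); apply: cvgM; first exact: cvg_cst.
exact: (cvgy_scale e0 ht).
Qed.

Lemma tail_cvg_of_tau : tau_ P X t 1 @[t --> +oo] --> 0 ->
  s * tailX s @[s --> +oo] --> 0.
Proof.
by under eq_fun do rewrite tau_tail// invr1 !mul1r.
Qed.

Lemma capsq_cvg_of_tail : s * tailX s @[s --> +oo] --> 0 ->
  capsq P X s / s @[s --> +oo] --> 0.
Proof.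
move=> ht.
(* [capsq_double] divided by [2 * s] is the recursion for [capsq s / s]; the coefficient [3 / 2] is
   [3 * s ^+ 2 / (2 * s)] freed of one [s]. *)
apply: (@cvg0_halving _ _ (fun s => 3 / 2 * (s * tailX s))) => [s s0|s s0|].
- apply/andP; split; first by rewrite divr_ge0 ?capsq_ge0// ltW.
  by rewrite ler_pdivrMr// -expr2 capsq_le_sqr// ltW.
- have := capsq_double P mX (ltW s0).
  rewrite -(ler_pM2r (_ : 0 < (2 * s)^-1)) ?invr_gt0 ?mulr_gt0// => /le_trans.
  by apply; rewrite le_eqVlt; apply/orP; left; apply/eqP; field; rewrite gt_eqF.
- by rewrite -(mulr0 (3 / 2)); apply: cvgM => //; exact: cvg_cst.
Qed.

Lemma cvg_rho e : 0 < e -> s * tailX s @[s --> +oo] --> 0 ->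
  rho_ P X t e @[t --> +oo] --> 0.
Proof.
move=> e0 /capsq_cvg_of_tail hc.
rewrite (_ : rho_ P X ^~ e = fun t => e * (capsq P X (e * t) / (e * t))).
  rewrite -(mulr0 e); apply: cvgM; first exact: cvg_cst.
  exact: (cvgy_scale e0 hc).
(* The identity is claimed for every [t]; at 0 both sides vanish because [0^-1 = 0]. *)
apply/funext => t; rewrite rho_capsq; have [->|t0] := eqVneq t 0.
  by rewrite invr0 mulr0 invr0 mul0r !mulr0.
by field; rewrite t0 gt_eqF.
Qed.

Lemma tail_cvg_of_rho : rho_ P X t 1 @[t --> +oo] --> 0 ->
  s * tailX s @[s --> +oo] --> 0.
Proof.
apply: squeeze_cvgr; last exact: cvg_cst.
apply/near_pinftyP; exists 1 => // s s1; have s0 : 0 < s by lra.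
rewrite tail_term_ge0//= rho_capsq mul1r ler_pdivlMl//.
by rewrite mulrA -expr2 tail_le_capsq// ltW.
Qed.

Lemma cvg_sigma e : 0 < e -> s * tailX s @[s --> +oo] --> 0 ->
  sigma_ P X t e @[t --> +oo] --> 0.
Proof.
move=> e0 /(cvg_rho e0); apply: squeeze_cvgr; last exact: cvg_cst.
apply/near_pinftyP; exists 1 => // s s1; have s0 : 0 <= s by lra.
rewrite sigma_ge0//= sigma_cutsq rho_capsq.
by rewrite ler_wpM2l ?invr_ge0// cutsq_le_capsq// mulr_ge0// ltW.
Qed.

Lemma cvg_v e : sigma_ P X t e @[t --> +oo] --> 0 ->
  v_ P X t e @[t --> +oo] --> 0.
Proof.
apply: squeeze_cvgr; last exact: cvg_cst.
apply/near_pinftyP; exists 1 => // s s1; have s0 : 0 <= s by lra.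
by rewrite v_ge0 ?v_le_sigma.
Qed.

(* With [a = s / 4], the truncated means are at most
   [a + 4 s tail a <= s / 2] once [tail a <= 1 / 16]. *)
Lemma Var_cut_ge_near : \forall s \near +oo, forall t, 2 * s <= t <= 4 * s ->
  s ^+ 2 / 4 * (tailX s - tailX (2 * s)) <= Var P (cut X t).
Proof.
have /cvgr0Pnorm_le tc := tail_cvg0 P mX.
have /near_pinftyP[S S0 tS] := tc 16^-1 ltac:(by rewrite invr_gt0).
apply/near_pinftyP; exists (4 * S); first by rewrite mulr_gt0.
move=> s sS t /andP[t2 t4]; apply: Var_cut_ge => //; first lra.
have h : tailX (s / 4) <= 16^-1 by rewrite (le_trans (ler_norm _)) ?tS//; lra.
have s4 : 0 <= s / 4 by lra.
have t0 : 0 <= t by lra.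
apply: (le_trans (mean_cut_bound P mX s4 t0)).
have := ler_pM t0 (tail_ge0 P X _) t4 h; lra.
Qed.

Lemma tail_cvg_of_increment :
  s * (tailX s - tailX (2 * s)) @[s --> +oo] --> 0 ->
  s * tailX s @[s --> +oo] --> 0.
Proof.
apply: cvg0_dyadic_telescope => [s _|]; first exact: tail_ge0.
exact: tail_cvg0.
Qed.

Let increment_ge0 s : 0 <= s -> 0 <= tailX s - tailX (2 * s).
Proof. by move=> s0; rewrite subr_ge0 tail_nonincreasing//; lra. Qed.

Lemma tail_cvg_of_v : v_ P X t 1 @[t --> +oo] --> 0 ->
  s * tailX s @[s --> +oo] --> 0.
Proof.
move=> hv; apply: tail_cvg_of_increment.
(* [Var_cut_ge_near] at [t = 2 * s] gives s (tail s - tail 2s) <= 4 Var / s, and this is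
   [8 * v_ P X (2 * s) 1]. *)
have : 8 * v_ P X (2 * s) 1 @[s --> +oo] --> 0.
  rewrite -(mulr0 8); apply: cvgM; first exact: cvg_cst.
  exact: (cvgy_scale _ hv).
apply: squeeze_cvgr; last exact: cvg_cst.
near=> s; have s0 : 0 < s by near: s; exact: nbhs_pinfty_gt.
rewrite mulr_ge0 ?increment_ge0 ?(ltW s0)//= v_Var_cut mul1r.
have hU : forall t, 2 * s <= t <= 4 * s ->
    s ^+ 2 / 4 * (tailX s - tailX (2 * s)) <= Var P (cut X t).
  by near: s; exact: Var_cut_ge_near.
have {}hU := hU (2 * s) ltac:(lra).
set V := Var P _ in hU *.
have -> : 8 * ((2 * s)^-1 * V) = 4 * V / s by field; lra.
by rewrite ler_pdivlMr//; lra.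
Unshelve. all: by end_near. Qed.

(** The integrand is at most [a / 2] beyond [S] and at most [t <= S] before it, a probability being
    at most 1. The initial piece contributes at most [S ^+ 2], absorbed once
    [2 * S ^+ 2 / a <= M]. *)
Lemma cesaro_tau_cvg e : tau_ P X t e @[t --> +oo] --> 0 ->
  ((M : R)^-1%:E * \int[mu]_(t in `[0%R, M]) (tau_ P X t e)%:E)%E
    @[M --> +oo%R] --> 0%E.
Proof.
move=> /cvgy0P ht.
have {}ht := ht (fun s s0 => tau_ge0 e (ltW s0)).
apply/cvge0P.
  near=> M; apply: mule_ge0; first rewrite lee_fin invr_ge0.
    by near: M; exact/nbhs_pinfty_ge/num_real.
  apply: integral_ge0 => t/=; rewrite in_itv/= => /andP[t0 _].
  by rewrite lee_fin tau_ge0.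
move=> a a0; have [S S0 tS] := ht (a / 2) ltac:(by rewrite divr_gt0).
near=> M.
have MS : S <= M by near: M; exact/nbhs_pinfty_ge/num_real.
have MS2 : 2 * S ^+ 2 / a <= M by near: M; exact/nbhs_pinfty_ge/num_real.
have M0 : 0 < M by lra.
have : (\int[mu]_(t in `[0%R, M]) (tau_ P X t e)%:E <=
  \int[mu]_(t in `[0%R, M])
    ((a / 2 * \1_`[0%R, M] t)%:E + (S * \1_`[0%R, S] t)%:E))%E.
  apply: ge0_le_integral_nonmeasurable => t /= tM; have := tM;
    rewrite in_itv/= => /andP[t0 _].
    by rewrite lee_fin tau_ge0.
  rewrite -EFinD lee_fin !indicE mem_set// mulr1.
  have [St|tS'] := leP S t.
    by rewrite (le_trans (tS _ St))// lerDl mulr_ge0// ltW.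
  rewrite mem_set/=; last by rewrite in_itv/= t0 ltW.
  apply: (@le_trans _ _ t); last lra.
  rewrite /tau_ ler_piMr// fine_prob_le1//.
  exact: measurable_tail_set.
rewrite ge0_integralD//; last 4 first.
- by move=> t _; rewrite lee_fin mulr_ge0// ltW// divr_gt0.
- apply/measurable_EFinP; apply: measurable_funM => //.
- by move=> t _; rewrite lee_fin mulr_ge0// ltW.
- apply/measurable_EFinP; apply: measurable_funM => //.
rewrite !integral_cst_indic ?(ltW S0) ?divr_ge0 ?(ltW a0)//.
rewrite setIid (setIidl (_ : `[0, S] `<=` `[0, M])); last first.
  by apply: subset_itvl; rewrite bnd_simp.
rewrite !mu_itvcc ?(ltW S0) ?(ltW M0)// !subr0 -!EFinM -EFinD => h.
apply: (@le_trans _ _ (M^-1 * (a / 2 * M + S * S))%:E).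
  by rewrite EFinM lee_pmul2l// ?lte_fin ?invr_gt0.
rewrite lee_fin ler_pdivrMl//; move: MS2; rewrite ler_pdivrMr//; lra.
Unshelve. all: by end_near. Qed.

(** On [[M / 2, M]] the integrand is at least [M / 2 * tail M], as [tail] is nonincreasing; this
    half alone makes the average at least [M * tail M / 4]. *)
Lemma tail_cvg_of_cesaro :
  ((M : R)^-1%:E * \int[mu]_(t in `[0%R, M]) (tau_ P X t 1)%:E)%E
    @[M --> +oo%R] --> 0%E ->
  s * tailX s @[s --> +oo] --> 0.
Proof.
move/cvge0P => hc; apply/cvgy0P => [//|a a0].
apply/near_pinftyP.
have a4 : 0 < a / 4 by rewrite divr_gt0.
have {}hc := hc _ (a / 4) a4.
near=> M; have M0 : 0 < M by near: M; exact: nbhs_pinfty_gt.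
have : ((M : R)^-1%:E * \int[mu]_(t in `[0%R, M]) (tau_ P X t 1)%:E <=
    (a / 4)%:E)%E.
  near: M; apply: hc; near=> M; apply: mule_ge0.
    by rewrite lee_fin invr_ge0; near: M; exact/nbhs_pinfty_ge/num_real.
  apply: integral_ge0 => t/=; rewrite in_itv/= => /andP[t0 _].
  by rewrite lee_fin tau_ge0.
suff : ((M / 2 * tailX M)%:E * mu `[(M / 2)%R, M%R] <=
  \int[mu]_(t in `[0%R, M]) (tau_ P X t 1)%:E)%E.
  rewrite mu_itvcc; last lra.
  move=> h1 h2; have :
      ((M : R)^-1%:E * ((M / 2 * tailX M)%:E * (M - M / 2)%:E) <= (a / 4)%:E)%E.
    by apply: le_trans h2; rewrite lee_pmul2l// lte_fin invr_gt0.
  rewrite -!EFinM lee_fin.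
  have -> : M^-1 * (M / 2 * tailX M * (M - M / 2)) = M * tailX M / 4.
    by field; lra.
  lra.
apply: cst_le_integral => //.
- by apply: subset_itvr; rewrite bnd_simp; lra.
- by rewrite mulr_ge0 ?tail_ge0//; lra.
- by move=> t/=; rewrite in_itv/= => /andP[t0 _]; rewrite lee_fin tau_ge0.
- move=> t/=; rewrite in_itv/= => /andP[t1 t2]; rewrite lee_fin /tau_ mul1r.
  apply: ler_pM => //; [lra|exact: tail_ge0|exact: tail_nonincreasing].
Unshelve. all: by end_near. Qed.

Lemma integral_sigma_cvg e : sigma_ P X t e @[t --> +oo] --> 0 ->
  (M%:E * \int[mu]_(t in `[M%R, +oo[) (sigma_ P X t e / t ^+ 2)%:E)%E
    @[M --> +oo%R] --> 0%E.
Proof.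
move=> /cvgy0P ht.
have {}ht := ht (fun s s0 => sigma_ge0 e (ltW s0)).
apply/cvge0P.
  near=> M; have M0 : 0 <= M by near: M; exact/nbhs_pinfty_ge/num_real.
  apply: mule_ge0; rewrite ?lee_fin//.
  apply: integral_ge0 => t/=; rewrite in_itv/= andbT => Mt.
  by rewrite lee_fin divr_ge0 ?sqr_ge0 ?sigma_ge0//; lra.
move=> a a0; have [S S0 tS] := ht a a0.
near=> M.
have MS : S <= M by near: M; exact/nbhs_pinfty_ge/num_real.
have M0 : 0 < M by lra.
(* [a / M] is the integral of [a / t ^+ 2] over [[M, +oo[], the majorant once [sigma_] is at most
   [a]. *)
have -> : a%:E = (M%:E * (a / M)%:E)%E by rewrite -EFinM; congr EFin; field; lra.
rewrite lee_pmul2l// -integral_inv_sqr ?(ltW a0)//.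
apply: ge0_le_integral_nonmeasurable => t/=; rewrite in_itv/= andbT => Mt.
  by rewrite lee_fin divr_ge0 ?sqr_ge0 ?sigma_ge0//; lra.
by rewrite lee_fin ler_wpM2r ?invr_ge0 ?sqr_ge0// tS//; lra.
Unshelve. all: by end_near. Qed.

Lemma integral_v_cvg e :
  (M%:E * \int[mu]_(t in `[M%R, +oo[) (sigma_ P X t e / t ^+ 2)%:E)%E
    @[M --> +oo%R] --> 0%E ->
  (M%:E * \int[mu]_(t in `[M%R, +oo[) (v_ P X t e / t ^+ 2)%:E)%E
    @[M --> +oo%R] --> 0%E.
Proof.
apply: squeeze_cvge; last exact: cvg_cst.
near=> M; have M0 : 0 < M by near: M; exact: nbhs_pinfty_gt.
apply/andP; split.
  apply: mule_ge0; first by rewrite lee_fin ltW.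
  apply: integral_ge0 => t/=; rewrite in_itv/= andbT => Mt.
  by rewrite lee_fin divr_ge0 ?sqr_ge0 ?v_ge0//; lra.
rewrite lee_pmul2l//.
apply: ge0_le_integral_nonmeasurable => t/=; rewrite in_itv/= andbT => Mt.
  by rewrite lee_fin divr_ge0 ?sqr_ge0 ?v_ge0//; lra.
by rewrite lee_fin ler_wpM2r ?invr_ge0 ?sqr_ge0// v_le_sigma//; lra.
Unshelve. all: by end_near. Qed.

(** Take [M = 2 * s] and keep only [2 s <= t <= 4 s]. With D = tail s - tail 2s the integrand Var /
    t^3 is at least (s^2 D / 4) / (4 s)^3 = D / (256 s); the length 2s and the factor M turn this
    into s D / 64. *)
Lemma tail_cvg_of_integral_v :
  (M%:E * \int[mu]_(t in `[M%R, +oo[) (v_ P X t 1 / t ^+ 2)%:E)%E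
    @[M --> +oo%R] --> 0%E ->
  s * tailX s @[s --> +oo] --> 0.
Proof.
move/cvge0P => hv; apply: tail_cvg_of_increment.
apply/cvgy0P => [s s0|a a0].
  by rewrite mulr_ge0 ?increment_ge0 ?ltW.
have a64 : 0 < a / 64 by rewrite divr_gt0.
have /near_pinftyP[S S0 hS] : \forall M \near +oo,
    (M%:E * \int[mu]_(t in `[M%R, +oo[) (v_ P X t 1 / t ^+ 2)%:E <=
      (a / 64)%:E)%E.
  apply: hv => //; near=> M.
  have M0 : 0 <= M by near: M; exact/nbhs_pinfty_ge/num_real.
  apply: mule_ge0; rewrite ?lee_fin//.
  apply: integral_ge0 => t/=; rewrite in_itv/= andbT => Mt.
  by rewrite lee_fin divr_ge0 ?sqr_ge0 ?v_ge0//; lra.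
have /near_pinftyP[U U0 hU] := Var_cut_ge_near.
exists (S + U) => [|s sSU]; first lra.
have s0 : 0 < s by lra.
have {}hS := hS (2 * s) ltac:(lra); have {}hU := hU s ltac:(lra).
set D := tailX s - _ in hU *.
have D0 : 0 <= D by exact/increment_ge0/ltW.
suff : ((D / (256 * s))%:E * mu `[(2 * s)%R, (4 * s)%R] <=
  \int[mu]_(t in `[(2 * s)%R, +oo[) (v_ P X t 1 / t ^+ 2)%:E)%E.
  rewrite mu_itvcc; last lra.
  move=> h1; have :
      ((2 * s)%:E * ((D / (256 * s))%:E * (4 * s - 2 * s)%:E) <= (a / 64)%:E)%E.
    by apply: le_trans hS; rewrite lee_pmul2l// lte_fin mulr_gt0.
  rewrite -!EFinM lee_fin.
  have -> : 2 * s * (D / (256 * s) * (4 * s - 2 * s)) = s * D / 64.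
    by field; lra.
  lra.
apply: cst_le_integral => //.
- by move=> t/=; rewrite !in_itv/= andbT => /andP[].
- by rewrite divr_ge0//; lra.
- move=> t/=; rewrite in_itv/= andbT => st.
  by rewrite lee_fin divr_ge0 ?sqr_ge0 ?v_ge0//; lra.
- move=> t/=; rewrite in_itv/= => st; have /andP[st1 st2] := st.
  rewrite lee_fin v_Var_cut mul1r ler_pdivlMr ?exprn_gt0//; last lra.
  rewrite ler_pdivlMl; last lra.
  apply: le_trans (hU _ st).
  have -> : t * (D / (256 * s) * t ^+ 2) = t ^+ 3 * (D / (256 * s)) by ring.
  have -> : s ^+ 2 / 4 * D = (4 * s) ^+ 3 * (D / (256 * s)) by field; lra.
  rewrite ler_wpM2r ?divr_ge0 ?lerXn2r ?nnegrE//; lra.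
Unshelve. all: by end_near. Qed.

End equivalences.

(** * Expectations through laws, products of independent variables, union bound *)

Section independence.
Context {d : measure_display} {T : measurableType d} {R : realType}.
Variable P : probability T R.

Definition prob_independent (X Y : T -> R) := forall A B : set R,
  measurable A -> measurable B ->
  (P (X @^-1` A `&` Y @^-1` B) = P (X @^-1` A) * P (Y @^-1` B))%E.

Lemma Exp_distribution (X : {RV P >-> R}) (f : R -> R) :
  measurable_fun setT f -> (exists M, forall x, `|f x| <= M) ->
  Exp P (f \o X) = Exp (distribution P X) f.
Proof.
move=> mf [M fM]; rewrite /Exp /Rintegral; congr fine.
have /integral_distribution -> // : measurable_fun setT (EFin \o f).
  exact/measurable_EFinP.
apply: mbounded_integrable; split; first exact: measurableT_comp.
by exists M => x /=.
Qed.

Lemma Exp_identically_distributed (X Y : {RV P >-> R}) (f : R -> R) :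
  (forall B, measurable B -> P (X @^-1` B) = P (Y @^-1` B)) ->
  measurable_fun setT f -> (exists M, forall x, `|f x| <= M) ->
  Exp P (f \o X) = Exp P (f \o Y).
Proof.
move=> XY mf bf; rewrite !Exp_distribution//; congr fine.
by apply: eq_measure_integral => /= B mB _; exact: XY.
Qed.

(** By uniqueness of product measures, agreement on rectangles makes the joint law the product of
    the marginals; Fubini then factors the integral. *)
Lemma Exp_independentM (X Y : {RV P >-> R}) (f g : R -> R) :
  prob_independent X Y ->
  measurable_fun setT f -> (exists M, forall x, `|f x| <= M) ->
  measurable_fun setT g -> (exists M, forall x, `|g x| <= M) ->
  Exp P (fun x => f (X x) * g (Y x)) = Exp P (f \o X) * Exp P (g \o Y).
Proof.
move=> XY mf bf mg bg; have [M fM] := bf; have [M' gM] := bg.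
have mXY : measurable_fun setT (fun x => (X x, Y x)).
  by apply/measurable_fun_pairP; split; exact: measurable_funPT.
pose Z : {RV P >-> (R * R)%type} := MeasurableFun.Pack (MeasurableFun.Class
  (isMeasurableFun.Build _ _ _ _ _ mXY)).
pose F (z : R * R) := f z.1 * g z.2.
have mF : measurable_fun setT F.
  by apply: measurable_funM; exact: measurableT_comp.
have bF : exists K, forall z, `|F z| <= K.
  by exists (M * M') => z; rewrite normrM ler_pM.
have dZ (W : set (R * R)) : measurable W ->
    (distribution P X \x distribution P Y)%E W = distribution P Z W.
  by apply: product_measure_unique => A B mA mB; exact: XY.
have FZ : (distribution P Z).-integrable setT (EFin \o F).
  exact: mbounded_integrable.
have FXY : (distribution P X \x distribution P Y)%E.-integrable setT (EFin \o F).
  have /integrableP[_ Foo] := FZ; apply/integrableP; split.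
    exact/measurable_EFinP.
  by rewrite (eq_measure_integral (distribution P Z)) => [//|W mW _]; exact: dZ.
have -> : Exp P (fun x => f (X x) * g (Y x)) = Exp (distribution P Z) F.
  have mEF : measurable_fun setT (EFin \o F) by exact/measurable_EFinP.
  have iF : P.-integrable setT ((EFin \o F) \o Z).
    apply: mbounded_integrable; split; first exact: (measurableT_comp mF mXY).
    by case: bF => K FK; exists K => x; exact: FK.
  by rewrite /Exp /Rintegral -(integral_distribution mEF iF).
rewrite !Exp_distribution// /Exp /Rintegral.
have <- : (\int[distribution P X \x distribution P Y]_z (F z)%:E =
    \int[distribution P Z]_z (F z)%:E)%E.
  by apply: eq_measure_integral => W mW _; exact: dZ.
rewrite -(integral12_prod_meas1 FXY) /fubini_F/=.
have fX : (distribution P X).-integrable setT (EFin \o f).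
  exact: mbounded_integrable.
have gY : (distribution P Y).-integrable setT (EFin \o g).
  exact: mbounded_integrable.
under eq_integral => x _.
  rewrite /F/=; under eq_integral do rewrite EFinM.
  rewrite integralZl//.
  rewrite -(fineK (integrable_fin_num measurableT gY)).
  over.
by rewrite integralZr// fineM// ?integrable_fin_num.
Qed.

Lemma fine_prob_bigcup_le (A : nat -> set T) (p : R) :
  (forall n, measurable (A n)) -> (forall n, fine (P (A n)) <= p) ->
  forall N, fine (P (\bigcup_(n < N) A n)) <= N%:R * p.
Proof.
move=> mA Ap; elim=> [|N ih].
  by rewrite II0 bigcup_set0 measure0 mul0r.
rewrite IIS bigcup_setU bigcup_set1 -natr1 mulrDl mul1r.
have mU : measurable (\bigcup_(n < N) A n) by exact: bigcup_measurable.
by rewrite (le_trans (fine_probU _ _ _))// lerD.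
Qed.

End independence.

(** * Sufficiency of the tail condition *)

Section weak_law.
Context {d : measure_display} {T : measurableType d} {R : realType}.
Variables (P : probability T R) (h : nat -> {RV P >-> R}).
Hypothesis iid_h : iid P (fun n => h n).

Let mh n : measurable_fun setT (h n). Proof. exact: measurable_funPT. Qed.

Lemma pairwise_independent i j : i != j -> prob_independent P (h i) (h j).
Proof.
move=> ij A B mA mB; have ji : (j == i) = false by rewrite eq_sym (negbTE ij).
pose C k := if k == i then A else B.
have mC k : measurable (C k) by rewrite /C; case: ifP.
have uij : uniq [:: i; j] by rewrite /= inE ij.
have := iid_h.1 _ C uij mC.
rewrite big_cons big_seq1 {2 3}/C eqxx ji => <-; congr (P _).
apply/seteqP; split=> x /=.
  move=> [Ax Bx] k /=; rewrite !inE => /orP[|] /eqP->.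
    by rewrite /C eqxx.
  by rewrite /C ji.
move=> Cx; split; [have := Cx i|have := Cx j].
  by rewrite /= /C eqxx; apply; rewrite mem_head.
by rewrite /= /C ji; apply; rewrite !inE eqxx orbT.
Qed.

Lemma tail_iid n s : tail P (h n) s = tail P (h 0%N) s.
Proof.
have mB : measurable [set x : R | s < `|x|].
  by apply: (measurable_tail_set (X := id)).
by congr fine; exact: (iid_h.2 n _ mB).
Qed.

Lemma measurable_partial_sum N :
  measurable_fun setT (fun x => \sum_(n < N) h n x).
Proof. by apply: measurable_sum => n. Qed.

Lemma measurable_dev_set (N : nat) (c e : R) :
  measurable [set x | e < `|N%:R^-1 * \sum_(n < N) h n x - c|].
Proof.
apply: (measurable_tail_set (X := fun x => N%:R^-1 * \sum_(n < N) h n x - c)).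
apply: measurable_funB => //; apply: measurable_funM => //.
exact: measurable_partial_sum.
Qed.

(** Off-diagonal products have zero mean by pairwise independence and centring; the diagonal ones
    share the law of the term of index 0. *)
Lemma Exp_sqr_sum_centered (N : nat) (f : R -> R) :
  measurable_fun setT f -> (exists M, forall x, `|f x| <= M) ->
  Exp P (f \o h 0%N) = 0 ->
  Exp P (fun x => (\sum_(n < N) f (h n x)) ^+ 2) =
  N%:R * Exp P (fun x => f (h 0%N x) ^+ 2).
Proof.
move=> mf bf f0.
have bfh n : mbounded (fun x => f (h n x)).
  split; first exact: (measurableT_comp mf (mh n)).
  by case: bf => M fM; exists M => x.
have fn0 n : Exp P (f \o h n) = 0.
  by rewrite -f0; apply: Exp_identically_distributed => // B; exact: iid_h.2.
under eq_fun do rewrite expr2 big_distrlr/=.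
rewrite Exp_sum => [|i]; last first.
  by apply: mbounded_sum => j; exact: mboundedM.
under eq_bigr => i _.
  rewrite Exp_sum => [|j]; last exact: mboundedM.
  rewrite (bigD1 i)//= big1 ?addr0 => [|j ji]; last first.
    rewrite (Exp_independentM (X := h i) (Y := h j) (f := f) (g := f))//.
      by rewrite fn0 mul0r.
    by apply: pairwise_independent; rewrite eq_sym.
  rewrite (_ : Exp P _ = Exp P (fun x => f (h 0%N x) ^+ 2)); last first.
    apply: (Exp_identically_distributed (X := h i) (Y := h 0%N)
      (f := fun y => f y * f y)) => [B|//|]; first exact: iid_h.2.
      exact: measurable_funM.
    by case: bf => M fM; exists (M * M) => x; rewrite normrM ler_pM.
  over.
by rewrite sumr_const card_ord mulr_natl.
Qed.

(* Truncate at level [N]; the centred truncated sum is controlled in L^2. *)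
Lemma dev_prob_le (N : nat) (e : R) : (0 < N)%N -> 0 < e ->
  (dev_prob P (fun n => h n) N (delta_ P (h 0%N) N%:R 1) e <=
   (tau_ P (h 0%N) N%:R 1 + e ^- 2 * sigma_ P (h 0%N) N%:R 1)%:E)%E.
Proof.
move=> N0 e0; set X := (h 0%N : T -> R).
have n0 : 0 < N%:R :> R by rewrite ltr0n.
(* Truncation is taken as a function on the reals, so that the same [f] composes with every
   [h n]. *)
pose m := delta_ P X N%:R 1; pose c := cut (id : R -> R) N%:R.
pose f y := c y - m.
have mc : mbounded c by apply: mbounded_cut; exact: measurable_id.
have [mf bf] : mbounded f by apply: mboundedB mc _; exact: mbounded_cst.
have mE : m = Exp P (cut X N%:R) by rewrite /m /delta_ /trunc mul1r.
have f0 : Exp P (f \o h 0%N) = 0.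
  rewrite /comp ExpB; last exact: mbounded_cst.
    by rewrite Exp_cst mE subrr.
  exact: (mbounded_cut (mh 0%N)).
have fV : Exp P (fun x => f (X x) ^+ 2) = Var P (cut X N%:R).
  by rewrite /Var -mE.
have bZ : mbounded (fun x => N%:R^-1 * \sum_(n < N) f (h n x)).
  apply: mboundedM; first exact: mbounded_cst.
  apply: mbounded_sum => n; split; first exact: (measurableT_comp mf (mh n)).
  by case: bf => M fM; exists M => x.
set Z := (fun x => _) in bZ.
have mA n : measurable [set x | N%:R < `|h n x|] by exact: measurable_tail_set.
have mU : measurable (\bigcup_(n < N) [set x | N%:R < `|h n x|]).
  exact: bigcup_measurable.
have mW := measurable_tail_set bZ.1 e.
rewrite /dev_prob fine_probE ?lee_fin; last exact: measurable_dev_set.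
(* Unless some term exceeds [N], truncation alters no summand and [Z] is exactly the deviation. The
   union costs N tail N, that is [tau_]; the variance of [Z] is Var / N, at most [sigma_]. *)
apply: (@le_trans _ _ (fine (P ((\bigcup_(n < N) [set x | N%:R < `|h n x|]) `|`
    [set x | e < `|Z x|])))).
  apply: fine_prob_le => [||x /= ex].
  - exact: measurable_dev_set.
  - exact: measurableU.
  have [|hN] := pselect ((\bigcup_(n < N) [set x | N%:R < `|h n x|]) x).
    by left.
  right; rewrite (_ : Z x = N%:R^-1 * \sum_(n < N) h n x - m)//.
  rewrite /Z (_ : \sum_(n < N) f (h n x) = \sum_(n < N) h n x - N%:R * m).
    by rewrite mulrBr mulKf ?gt_eqF.
  rewrite (eq_bigr (fun n : 'I_N => h n x - m)) => [|n _].
    by rewrite sumrB sumr_const card_ord mulr_natl.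
  rewrite /f /c /cut ifT// leNgt; apply/negP => hn.
  by apply: hN; exists (n : nat) => //=.
apply: (le_trans (fine_probU _ mU mW)); apply: lerD.
  apply: fine_prob_bigcup_le => // n.
  by rewrite -[leLHS]/(tail P (h n) _) tail_iid mul1r.
have := sqr_markov P bZ (ltW e0).
rewrite -ler_pdivlMl ?exprn_gt0// => /le_trans; apply.
rewrite ler_pM2l ?invr_gt0 ?exprn_gt0//.
under eq_fun do rewrite exprMn.
rewrite ExpZ; last first.
  apply: mboundedX; apply: mbounded_sum => n; split.
    exact: (measurableT_comp mf (mh n)).
  by case: bf => M fM; exists M => x.
rewrite Exp_sqr_sum_centered// fV sigma_cutsq mul1r expr2 mulrA mulfVK ?gt_eqF//.
rewrite ler_wpM2l ?invr_ge0// Var_cut_le_cutsq//.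
Qed.

Lemma weak_law : s * tail P (h 0%N) s @[s --> +oo] --> 0 ->
  forall e : R, 0 < e ->
  (fun N => dev_prob P (fun n => h n) N (delta_ P (h 0%N) N%:R 1) e) @ \oo
    --> 0%E.
Proof.
move=> ht e e0.
have : tau_ P (h 0%N) N%:R 1 + e ^- 2 * sigma_ P (h 0%N) N%:R 1
    @[N --> \oo] --> 0.
  rewrite -(addr0 0) -[X in 0 + X](mulr0 (e ^- 2)); apply: cvgD.
    apply: (@cvg_comp _ _ _ (fun N => N%:R) (tau_ P (h 0%N) ^~ 1)).
      exact: cvgr_idn.
    exact: cvg_tau.
  apply: cvgM; first exact: cvg_cst.
  apply: (@cvg_comp _ _ _ (fun N => N%:R) (sigma_ P (h 0%N) ^~ 1)).
    exact: cvgr_idn.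
  exact: cvg_sigma.
move=> /cvgr0Pnorm_le hc.
apply/cvge0P; first by apply: nearW => N; exact: measure_ge0.
move=> a /hc ha; near=> N.
apply: (le_trans (dev_prob_le _ e0)); first by near: N; exact: nbhs_infty_gt.
by rewrite lee_fin (le_trans (ler_norm _))//; near: N.
Unshelve. all: by end_near. Qed.

End weak_law.

(** * Necessity of the tail condition *)

Section necessity.
Context {d : measure_display} {T : measurableType d} {R : realType}.
Variables (P : probability T R) (h : nat -> {RV P >-> R}).
Hypothesis iid_h : iid P (fun n => h n).

Let mh n : measurable_fun setT (h n). Proof. exact: measurable_funPT. Qed.

Definition others (N k : nat) : seq nat := [seq i <- iota 0 N | i != k].

(** A pi-system generating the sigma-algebra of the [h i] with [i < N] and [i != k]. *)
Definition other_cylinders (N k : nat) : set (set T) :=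
  [set C | exists2 B : nat -> set R, (forall i, measurable (B i)) &
    C = \bigcap_(i in [set` others N k]) (h i @^-1` B i)].

Lemma mem_others N k i : (i \in others N k) = (i != k) && (i < N)%N.
Proof. by rewrite mem_filter mem_iota. Qed.

(** Dynkin's theorem lifts the product rule from cylinders to events about sums of the other terms.
    Measurability in [T] is carried along because complements and disjoint unions need it. *)
Lemma indep_other_cylinders N k (A : set R) : measurable A ->
  forall C, <<s other_cylinders N k >> C ->
  measurable C /\ (P (h k @^-1` A `&` C) = P (h k @^-1` A) * P C)%E.
Proof.
move=> mA; set E := h k @^-1` A.
have mE : measurable E by rewrite -[E]setTI; exact: mh.
apply: (@dynkin_induction _
  (g_sigma_algebraType (other_cylinders N k)) (other_cylinders N k)).
- by [].
- move=> _ _ [B1 mB1 ->] [B2 mB2 ->]; exists (fun i => B1 i `&` B2 i).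
    by move=> i; exact: measurableI.
  by rewrite -bigcapI.
- by split => //; rewrite setIT probability_setT mule1.
- move=> _ [B mB ->]; split.
    by apply: bigcap_measurableType => i _; rewrite -[_ @^-1` _]setTI; exact: mh.
  (* Inserting [A] at coordinate [k] makes the intersection one cylinder over [k :: others N k],
     where mutual independence applies. *)
  pose B' i := if i == k then A else B i.
  have mB' i : measurable (B' i) by rewrite /B'; case: ifP.
  have uo : uniq (others N k) by rewrite filter_uniq ?iota_uniq.
  have uko : uniq (k :: others N k) by rewrite /= mem_others eqxx uo.
  have B'B i : i \in others N k -> B' i = B i.
    by rewrite mem_others /B' => /andP[/negbTE->].
  rewrite (iid_h.1 _ _ uo mB); transitivity
      (P (\bigcap_(i in [set` k :: others N k]) (h i @^-1` B' i))).
    congr (P _); apply/seteqP; split=> x.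
      move=> [Ax Cx] i /=; rewrite inE => /orP[/eqP->|io].
        by rewrite /B' eqxx.
      by rewrite B'B//; exact: Cx.
    move=> Bx; split.
      by have := Bx k (mem_head _ _); rewrite /= /B' eqxx.
    move=> i /= io; rewrite -B'B//; apply: Bx.
    by rewrite /= inE io orbT.
  rewrite (iid_h.1 _ _ uko mB') big_cons {1}/B' eqxx; congr (_ * _)%E.
  by rewrite big_seq [RHS]big_seq; apply: eq_bigr => i /B'B->.
- move=> C _ [mC EC]; split; first exact: measurableC.
  have PEoo : (P E < +oo)%E by rewrite (le_lt_trans (probability_le1 _ _)) ?ltry.
  have -> : P (E `&` ~` C) = (P E - P E * P C)%E by rewrite -EC -setDE measureD.
  rewrite probability_setC// (fine_probE P mE) (fine_probE P mC).
  by rewrite -EFinM -!EFinB -EFinM mulrBr mulr1.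
- move=> /= F _ tF FE.
  have mF n : d.-measurable (F n) by case: (FE n).
  have mUF : d.-measurable (\bigcup_n F n) by exact: bigcupT_measurable.
  split => //.
  have EF n : P (E `&` F n) = (P E * P (F n))%E by case: (FE n).
  rewrite setI_bigcupr !measure_semi_bigcup//.
  + rewrite (eq_eseriesr (fun n _ => EF n)).
    by rewrite (fine_probE P mE) nneseriesZl.
  + by move=> n; exact: measurableI.
  + exact: trivIset_setIl.
  + by apply: bigcupT_measurable => n; exact: measurableI.
Qed.

Let other_sum (N k : nat) x : R :=
  \sum_(i < N) (if (i : nat) == k then 0 else h i x).

Let measurable_other (N k i : nat) : (i < N)%N -> i != k ->
  measurable_fun [set: g_sigma_algebraType (other_cylinders N k)] (h i).
Proof.
move=> iN ik _ B mB; rewrite setTI.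
apply: sub_sigma_algebra; exists (fun j => if j == i then B else setT).
  by move=> j; case: ifP.
apply/seteqP; split=> x.
  by move=> Bx j _ /=; case: ifPn => // /eqP->.
move=> /(_ i); rewrite /= eqxx; apply.
by rewrite mem_others ik.
Qed.

Let measurable_other_sum N k :
  measurable_fun [set: g_sigma_algebraType (other_cylinders N k)]
    (other_sum N k).
Proof.
apply: measurable_sum => i.
by have [ik|ik] := eqVneq (i : nat) k => //; exact: measurable_other.
Qed.

Let sum_split N k x : (k < N)%N ->
  \sum_(i < N) h i x = h k x + other_sum N k x.
Proof.
move=> kN; rewrite (bigD1 (Ordinal kN))//=; congr (_ + _).
rewrite /other_sum [RHS](bigD1 (Ordinal kN))//= eqxx add0r.
by apply: eq_bigr => i; rewrite -val_eqE/= => /negbTE->.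
Qed.

(* If [h k] is large while the sum of the others is close to [c], then the
   whole sum is far from [c]; [h k] is independent both of that sum and of the
   events that earlier terms are large, so summing over [k] gives the bound. *)
Lemma large_term_bound N (c a : R) : 0 <= a ->
  let q := fine (P [set x | a < `|\sum_(n < N) h n x - c|]) in
  let p := tail P (h 0%N) (3 * a) in
  forall k, (k <= N)%N ->
    k%:R * p * (1 - (q + tail P (h 0%N) a) - k%:R * p) <= q.
Proof.
move=> a0 q p.
have p0 : 0 <= p by exact: tail_ge0.
pose A : set R := [set y | 3 * a < `|y|].
have mA : measurable A by apply: (measurable_tail_set (X := id)).
pose E n := h n @^-1` A.
have mE n : measurable (E n) by rewrite -[E n]setTI; exact: mh.
have pE n : fine (P (E n)) = p by rewrite -[LHS]/(tail P (h n) _) tail_iid.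
pose S x := \sum_(n < N) h n x.
have mS : measurable_fun setT S by exact: measurable_partial_sum.
pose Q := [set x | a < `|S x - c|].
have mQ : measurable Q.
  by apply: (measurable_tail_set (X := fun x => S x - c)); exact: measurable_funB.
pose D (n : nat) := [set x | `|other_sum N n x - c| <= 2 * a].
have sD n : <<s other_cylinders N n >> (D n).
  rewrite -[D n]setTI.
  have : measurable_fun [set: g_sigma_algebraType (other_cylinders N n)]
      (fun x => `|other_sum N n x - c| <= 2 * a).
    apply: measurable_fun_ler => //; apply: measurableT_comp => //.
    exact: measurable_funB.
  exact.
have mD n : measurable (D n).
  exact: (indep_other_cylinders (A := A) mA (sD n)).1.
pose W k := \bigcup_(n < k) E n.
have mW k : measurable (W k) by exact: bigcup_measurable.
have sW k : (k < N)%N -> <<s other_cylinders N k >> (W k).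
  move=> kN; apply: (@bigcup_measurable _
      (g_sigma_algebraType (other_cylinders N k))) => n /= nk.
  have := @measurable_other N k n (ltn_trans nk kN) (negbT (ltn_eqF nk)).
  by move=> /(_ measurableT A mA); rewrite setTI.
pose U k := \bigcup_(n < k) (E n `&` D n).
have mU k : measurable (U k).
  by apply: bigcup_measurable => n _; exact: measurableI.
pose L n := [set x | a < `|h n x|].
have mL n : measurable (L n) by exact: measurable_tail_set.
(* If the whole sum is within [a] of [c] and [|h n| <= a], the others are within [2 * a]; so the
   deviation probability itself controls how often [D n] fails. *)
have DC n : (n < N)%N -> 1 - (q + tail P (h 0%N) a) <= fine (P (D n)).
  move=> nN; rewrite -(tail_iid iid_h n) lerBlDl -lerBlDr -fine_prob_setC//.
  apply: (le_trans _ (fine_probU P mQ (mL n))).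
  apply: fine_prob_le => [||x]; [exact: measurableC|exact: measurableU|].
  move=> /negP; rewrite -ltNge => Dx.
  have [|Lx] := pselect (L n x); [by right|left].
  move/negP: Lx; rewrite -leNgt /Q/= /S (sum_split _ nN) => hx.
  have := ler_normB (h n x + other_sum N n x - c) (h n x).
  rewrite (_ : _ - c - h n x = other_sum N n x - c); last by ring.
  lra.
have UQ k : (k <= N)%N -> U k `<=` Q.
  move=> kN x [n /= nk [Ex Dx]]; rewrite /Q/= /S (sum_split _ (leq_trans nk kN)).
  have := ler_normB (h n x + other_sum N n x - c) (other_sum N n x - c).
  rewrite (_ : _ - c - _ = h n x); last by ring.
  by move: Ex Dx; rewrite /E /A /D /=; lra.
(* Removing [W k] makes the new piece disjoint from [U k]. It involves only indices below [k], so
   [V] stays independent of [E k], at a cost of at most [k%:R * p] in probability. *)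
have step k : (k < N)%N ->
    fine (P (U k)) + p * (1 - (q + tail P (h 0%N) a) - k%:R * p) <=
    fine (P (U k.+1)).
  move=> kN; pose V := D k `\` W k.
  have sV : <<s other_cylinders N k >> V.
    exact: (@measurableD _ (g_sigma_algebraType (other_cylinders N k)) _ _
      (sD k) (sW k kN)).
  have [mV EV] : d.-measurable V /\ (P (E k `&` V) = P (E k) * P V)%E.
    exact (indep_other_cylinders mA sV).
  have Vge : 1 - (q + tail P (h 0%N) a) - k%:R * p <= fine (P V).
    have Wk : fine (P (W k)) <= k%:R * p.
      by apply: fine_prob_bigcup_le => // n; rewrite pE.
    have DV : fine (P (D k)) <= fine (P V) + fine (P (W k)).
      apply: (le_trans _ (fine_probU P mV (mW k))).
      apply: fine_prob_le => // [|x Dx]; first exact: measurableU.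
      by have [|Wx] := pselect (W k x); [right|left].
    by have := DC k kN; lra.
  have mEV : measurable (E k `&` V) by exact: measurableI.
  have dUV : U k `&` (E k `&` V) = set0.
    apply/seteqP; split=> // x [[n nk [Ex _]] [_ [_ Wx]]].
    by apply: Wx; exists n.
  apply: (@le_trans _ _ (fine (P (U k `|` (E k `&` V))))).
    rewrite measureU//.
    rewrite fineD ?fin_num_measure// lerD2l.
    apply: (@le_trans _ _ (p * fine (P V))); first by rewrite ler_wpM2l.
    by rewrite -(pE k) -fineM ?fin_num_measure// -EV; exact: lexx.
  apply: fine_prob_le => // [|x]; first exact: measurableU.
  move=> [[n /= nk EDx]|[Ex [Dx _]]]; last by exists k => //=.
  by exists n => //=; exact: ltnW.
suff main k : (k <= N)%N ->
    k%:R * p * (1 - (q + tail P (h 0%N) a) - k%:R * p) <= fine (P (U k)).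
  by move=> k kN; apply: (le_trans (main k kN)); apply: fine_prob_le => //; exact: UQ.
elim: k => [|k ih] kN; first by rewrite !mul0r fine_prob_ge0.
apply: le_trans (step k kN); have := ih (ltnW kN).
(* The slack in the induction step is exactly (k + 1) p^2. *)
have := mulr_ge0 p0 p0; have := mulr_ge0 (ler0n R k) (mulr_ge0 p0 p0).
rewrite -natr1; nra.
Qed.

(** A discrete continuity argument: from [k%:R * p <= 4 * q] the next multiple z is at most
    [4 * q + p <= 1 / 2], so [1 - r - z >= 1 / 4] and the quadratic bound returns [z <= 4 * q]. *)
Lemma le_of_quadratic_bound (N : nat) (q p r : R) :
  0 <= p -> 0 <= q -> 4 * q + p <= 1 / 2 -> r <= 1 / 4 ->
  (forall k, (k <= N)%N -> k%:R * p * (1 - r - k%:R * p) <= q) ->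
  N%:R * p <= 4 * q.
Proof.
move=> p0 q0 qp r4 Hk.
suff main k : (k <= N)%N -> k%:R * p <= 4 * q by exact: main.
elim: k => [|k ih] kN; first by rewrite mul0r mulr_ge0.
have {}ih := ih (ltnW kN); have {}Hk := Hk _ kN.
have k0 : 0 <= k.+1%:R * p by rewrite mulr_ge0.
have : k.+1%:R * p <= 1 / 2 by rewrite -natr1 mulrDl mul1r; lra.
move: (k.+1%:R * p) Hk k0 => z Hz z0 z2.
have : z * (1 / 4) <= z * (1 - r - z) by rewrite ler_wpM2l//; lra.
lra.
Qed.

Lemma tail_cvg_of_weak_law (dd : nat -> R) :
  (forall e : R, 0 < e ->
    (fun N => dev_prob P (fun n => h n) N (dd N) e) @ \oo --> 0%E) ->
  s * tail P (h 0%N) s @[s --> +oo] --> 0.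
Proof.
(* Deviation [1 / 3] of the average is [N / 3] for the sum, so the level [3 * a] of
   [large_term_bound] is [N]. *)
move=> hd; have third0 : 0 < 1 / 3 :> R by rewrite divr_gt0.
have dev_ge0 : \forall N \near \oo,
    (0 <= dev_prob P (fun n => h n) N (dd N) (1 / 3))%E.
  by apply: nearW => N; exact: measure_ge0.
have /(cvge0P dev_ge0) hq := hd _ third0.
have /cvgr0Pnorm_le ht := tail_cvg0 P (mh 0%N).
apply/cvgy0P => [s s0|e e0]; first by rewrite mulr_ge0 ?tail_ge0 ?ltW.
have [S S0 tS] : exists2 S, 0 < S &
    forall s, S <= s -> tail P (h 0%N) s <= 1 / 8.
  have /near_pinftyP[S S0 tS] := ht (1 / 8) ltac:(by rewrite divr_gt0).
  by exists S => // s /tS; exact/le_trans/ler_norm.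
(* With N = trunc s, s < N + 1 <= 2 N gives s tail s <= 2 N tail N <= 8 q, hence [e / 8]. The bounds
   q <= 1/16 and tails <= 1/8 ensure 4 q + p <= 1/2 and r <= 1/4. *)
have [N1 _ q1] := hq (e / 8) ltac:(by rewrite divr_gt0).
have [N2 _ q2] := hq (1 / 16) ltac:(by rewrite divr_gt0).
exists (N1%:R + N2%:R + 3 * S + 1) => [|s sN].
  by rewrite ltr_wpDl// !addr_ge0// mulr_ge0// ltW.
have N1ge0 := ler0n R N1; have N2ge0 := ler0n R N2.
have s0 : 0 <= s by lra.
have /andP[Ns sN1] := truncn_itv s0.
set N := Num.trunc s in Ns sN1; rewrite -natr1 in sN1.
have NS : 3 * S <= N%:R by lra.
have N1N : (N1 <= N)%N by rewrite -(ler_nat R); lra.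
have N2N : (N2 <= N)%N by rewrite -(ler_nat R); lra.
have N0 : 0 < N%:R :> R by lra.
have Nge1 : 1 <= N%:R :> R by move: N0; rewrite ltr0n ler1n.
have devE : dev_prob P (fun n => h n) N (dd N) (1 / 3) =
    P [set x | N%:R / 3 < `|\sum_(n < N) h n x - N%:R * dd N|].
  congr (P _); apply/funext => x; congr is_true.
  rewrite -[in RHS](ltr_pM2l (_ : 0 < N%:R^-1)) ?invr_gt0//.
  rewrite mulrA mulVf ?gt_eqF//.
  rewrite -[X in X * `|_|]gtr0_norm ?invr_gt0// -normrM mulrBr mulKf ?gt_eqF//.
have mdev := measurable_dev_set h N (dd N) (1 / 3).
have a0 : 0 <= N%:R / 3 :> R by lra.
have := @large_term_bound N (N%:R * dd N) _ a0; rewrite /= -devE.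
have -> : 3 * (N%:R / 3) = N%:R :> R by field.
have := q1 N N1N; have := q2 N N2N.
rewrite /= {1 2}/dev_prob fine_probE// !lee_fin.
rewrite -/(dev_prob P (fun n => h n) N (dd N) (1 / 3)).
set q := fine _ => h2 h1 Hk.
have q0 : 0 <= q by exact: fine_prob_ge0.
have t1 : tail P (h 0%N) N%:R <= 1 / 8 by apply: tS; lra.
have t2 : tail P (h 0%N) (N%:R / 3) <= 1 / 8 by apply: tS; lra.
have h4 : N%:R * tail P (h 0%N) N%:R <= 4 * q.
  by apply: le_of_quadratic_bound Hk; [exact: tail_ge0|exact: q0|lra|lra].
apply: (@le_trans _ _ (2 * (N%:R * tail P (h 0%N) N%:R))); last lra.
rewrite mulrA ler_pM ?tail_ge0//; first lra.
exact: tail_nonincreasing.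
Qed.

End necessity.

Theorem theorem4p1 (R : realType) (d : measure_display) (T : measurableType d)
  (P : probability T R) (h : nat -> {RV P >-> R}) :
  iid P (fun n => h n) ->
  let X := (h 0%N : T -> R) in
  [<->
   (* (i) *)
   exists dd : nat -> R, forall eps : R, 0 < eps ->
     (fun N => dev_prob P (fun n => h n) N (dd N) eps) @ \oo --> 0%E;
   (* (ii) *)
   forall eps : R, 0 < eps -> tau_ P X M eps @[M --> +oo] --> 0;
   (* (ii)' *)
   forall eps : R, 0 < eps -> sigma_ P X M eps @[M --> +oo] --> 0;
   (* (ii)'' *)
   forall eps : R, 0 < eps -> v_ P X M eps @[M --> +oo] --> 0;
   (* (ii)''' *)
   forall eps : R, 0 < eps -> rho_ P X M eps @[M --> +oo] --> 0;
   (* (iii) *)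
   forall eps : R, 0 < eps ->
     (((M : R)^-1)%:E * \int[lebesgue_measure]_(t in `[0%R, M]) (tau_ P X t eps)%:E)%E
       @[M --> +oo] --> 0%E;
   (* (iii)' *)
   forall eps : R, 0 < eps ->
     ((M : R)%:E * \int[lebesgue_measure]_(t in `[M%R, +oo[) (sigma_ P X t eps / t ^+ 2)%:E)%E
       @[M --> +oo] --> 0%E;
   (* (iii)'' *)
   forall eps : R, 0 < eps ->
     ((M : R)%:E * \int[lebesgue_measure]_(t in `[M%R, +oo[) (v_ P X t eps / t ^+ 2)%:E)%E
       @[M --> +oo] --> 0%E
  ] /\
  ((forall eps : R, 0 < eps -> tau_ P X M eps @[M --> +oo] --> 0) ->
   forall eps : R, 0 < eps ->
     (fun N => dev_prob P (fun n => h n) N (delta_ P X N%:R 1) eps) @ \oo --> 0%E).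
Proof.
move=> iid_h X; have mX : measurable_fun setT X by exact: measurable_funPT.
split; last by move=> ht; exact/weak_law/(tail_cvg_of_tau (ht 1 ltr01)).
(* One cycle in the listed order. Both passages from [sigma_] to [v_] are domination at fixed [eps];
   every other link goes through [s * tail P X s --> 0], extracted at [eps = 1], or at [1 / 3] from
   (i). *)
tfae.
- by move=> [dd hd] e e0; exact/(cvg_tau e0)/(tail_cvg_of_weak_law iid_h hd).
- by move=> ht e e0; exact/(cvg_sigma mX e0)/tail_cvg_of_tau/ht.
- by move=> hs e e0; exact/cvg_v/hs.
- by move=> hv e e0; exact/(cvg_rho mX e0)/(tail_cvg_of_v mX)/hv.
- move=> hr e e0; apply: cesaro_tau_cvg => //; apply: cvg_tau => //.
  exact/(tail_cvg_of_rho mX)/hr.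
- move=> ht e e0; apply: integral_sigma_cvg; apply: cvg_sigma => //.
  exact/(tail_cvg_of_cesaro mX)/ht.
- by move=> hs e e0; exact/integral_v_cvg/hs.
- move=> hv; exists (fun N => delta_ P X N%:R 1); apply: weak_law => //.
  exact/(tail_cvg_of_integral_v mX)/hv.
Qed.
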